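(* Consider a lottery (in the sense of the context) that is major, i.e. $t\ge 500$, and satisfies $F\ge 0.8$. Let $U$ and $L$ be the curves in the open first quadrant $$U=\Big\{(x,y): -1+\tfrac{1-0.45^{xy}}{x}=0\Big\},\qquad L=\Big\{(x,y): -0.8+\tfrac{1-0.36^{xy}}{x}=0\Big\}.$$ Then: (a) The break-even curve lies in the region bounded by $U$, $L$ and the $y$-axis; that is, every $(x,y)$ with $x,y>0$ and $\mathrm{eRoR}(x,y)=0$ satisfies $-1+\frac{1-0.45^{xy}}{x}<0<-0.8+\frac{1-0.36^{xy}}{x}$. (b) Any drawing with $(x,y)$ above the break-even curve (i.e. $0<x<1/F$ and $y>\ell(x)$, where the break-even curve is the graph of $\ell:(0,1/F)\to(0,\infty)$) has $\mathrm{eRoR}(x,y)>0$. (c) Any drawing with $(x,y)$ below the break-even curve (i.e. $0<x<1/F$ and $0<y<\ell(x)$) has $\mathrm{eRoR}(x,y)<0$. In particular, for any drawing of any such lottery, if $(x,y)$ is above $U$ (i.e. $-1+\frac{1-0.45^{xy}}{x}>0$) then the eRoR is positive, and if $(x,y)$ is below or to the right of $L$ (i.e. $-0.8+\frac{1-0.36^{xy}}{x}<0$) then the eRoR is negative.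
   Context: A lottery consists of: a number $t$ of distinct possible tickets (a positive integer); integers $c,d\ge 0$; positive integers $t^{\mathrm{fix}}_1,\dots,t^{\mathrm{fix}}_c$ and positive reals $a_1,\dots,a_c$ ($t^{\mathrm{fix}}_i$ of the tickets win a fixed prize $a_i$); positive integers $t^{\mathrm{pari}}_1,\dots,t^{\mathrm{pari}}_d$ and positive reals $r_1,\dots,r_d$ ($t^{\mathrm{pari}}_i$ of the tickets split a pot of size $r_iN$); and exactly one ticket that wins a share of the jackpot. These classes of tickets are disjoint, so $\sum_i t^{\mathrm{fix}}_i+\sum_i t^{\mathrm{pari}}_i+1\le t$. Put $f=1-\sum_{i=1}^c a_i t^{\mathrm{fix}}_i/t$, $F=f-\sum_{i=1}^d r_i$, $J_0=Ft$, $p=1/t$, $p_i=t^{\mathrm{pari}}_i/t$. It is a standing assumption that $0<F\le f\le 1$. A drawing is given by ticket sales $N>0$ and jackpot $J>0$; set $x=N/J$ and $y=J/J_0$, so $x,y>0$. Its expected rate of return is $$\mathrm{eRoR}(x,y)=-f+\sum_{i=1}^d r_i\big(1-(1-p_i)^{xyJ_0}\big)+\frac{1-(1-p)^{xyJ_0}}{x}.$$ The break-even curve is the set of $(x,y)$ with $x,y>0$ and $\mathrm{eRoR}(x,y)=0$; for $t\ge2$ it is the graph of a positive function $\ell$ with domain $(0,1/F)$. *)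

(* Defs.v *)
From HB Require Import structures.
From mathcomp Require Import all_boot all_order all_algebra.
From mathcomp Require Import all_classical all_reals all_analysis.
Set Implicit Arguments.
Unset Strict Implicit.
Unset Printing Implicit Defensive.
Import Order.TTheory GRing.Theory Num.Theory.
Local Open Scope classical_set_scope.
Local Open Scope ring_scope.

Record lottery (R : realType) := Lottery {
  tickets : nat;
  nfix : nat;
  npari : nat;
  tfix : 'I_nfix -> nat;
  prize : 'I_nfix -> R;
  tpari : 'I_npari -> nat;
  potrate : 'I_npari -> R;  (* the pot of class i is potrate i times the sales *)
  tickets_gt0 : (0 < tickets)%N;
  tfix_gt0 : forall i, (0 < tfix i)%N;
  prize_gt0 : forall i, 0 < prize i;
  tpari_gt0 : forall i, (0 < tpari i)%N;
  potrate_gt0 : forall i, 0 < potrate i;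
  (* disjointness of the winning classes; the 1 is the jackpot ticket *)
  winners_le : (\sum_i tfix i + \sum_i tpari i + 1 <= tickets)%N }.

Definition fval (R : realType) (l : lottery R) : R :=
  1 - \sum_(i < nfix l) prize i * (tfix i)%:R / (tickets l)%:R.
Definition Fval (R : realType) (l : lottery R) : R :=
  fval l - \sum_(i < npari l) potrate i.
Definition J0 (R : realType) (l : lottery R) : R := Fval l * (tickets l)%:R.
Definition pjack (R : realType) (l : lottery R) : R := 1 / (tickets l)%:R.
Definition ppari (R : realType) (l : lottery R) (i : 'I_(npari l)) : R :=
  (tpari i)%:R / (tickets l)%:R.

Definition standing_assumption (R : realType) (l : lottery R) : Prop :=
  [/\ 0 < Fval l, Fval l <= fval l & fval l <= 1].

Definition major (R : realType) (l : lottery R) : Prop := (500 <= tickets l)%N.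

Definition eRoR (R : realType) (l : lottery R) (x y : R) : R :=
  - fval l
  + \sum_(i < npari l) potrate i * (1 - (1 - ppari i) `^ (x * y * J0 l))
  + (1 - (1 - pjack l) `^ (x * y * J0 l)) / x.

Definition break_even (R : realType) (l : lottery R) : set (R * R) :=
  [set q | [/\ 0 < q.1, 0 < q.2 & eRoR l q.1 q.2 = 0]].

(* ell is total; only its values on the open interval (0, 1/F) matter *)
Definition break_even_graph (R : realType) (l : lottery R) (ell : R -> R) : Prop :=
  (forall x, 0 < x < 1 / Fval l -> 0 < ell x) /\
  break_even l = [set q | 0 < q.1 < 1 / Fval l /\ q.2 = ell q.1].

Record drawing (R : realType) := Drawing {
  sales : R;
  jackpot : R;
  sales_gt0 : 0 < sales;
  jackpot_gt0 : 0 < jackpot }.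

Definition xcoord (R : realType) (D : drawing R) : R := sales D / jackpot D.
Definition ycoord (R : realType) (l : lottery R) (D : drawing R) : R :=
  jackpot D / J0 l.

Definition above_break_even (R : realType) (l : lottery R) (ell : R -> R)
    (x y : R) : Prop := 0 < x < 1 / Fval l /\ ell x < y.
Definition below_break_even (R : realType) (l : lottery R) (ell : R -> R)
    (x y : R) : Prop := 0 < x < 1 / Fval l /\ 0 < y < ell x.

(* The curves U and L are the zero sets of these functions in the open first
   quadrant. A point is above U when curveU_fun is positive, and below or to the
   right of L when curveL_fun is negative. *)
Definition curveU_fun (R : realType) (x y : R) : R :=
  - 1 + (1 - (45 / 100) `^ (x * y)) / x.
Definition curveL_fun (R : realType) (x y : R) : R :=
  - (8 / 10) + (1 - (36 / 100) `^ (x * y)) / x.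

(* Main.v *)
Require Import Defs.
From HB Require Import structures.
From mathcomp Require Import all_boot all_order all_algebra.
From mathcomp Require Import all_classical all_reals all_analysis.
From mathcomp Require Import ring lra.
Set Implicit Arguments.
Unset Strict Implicit.
Unset Printing Implicit Defensive.
Import Order.TTheory GRing.Theory Num.Theory.
Import numFieldNormedType.Exports.
Local Open Scope ring_scope.

(* With q = (1 - 1/t)^(J0) the jackpot term of eRoR is (1 - q^(xy)) / x.  Since
   t >= 500 and 4/5 <= F <= 1, comparing 1 - 1/t with exponentials gives
   0.36 < exp(-500/499) <= q <= exp(-4/5) < 0.45.  The pari-mutuel sum lies
   between 0 and the sum of the r_i, hence curveU_fun < eRoR < curveL_fun on the
   whole open quadrant.  For fixed x, eRoR is continuous and strictly increasing
   in y, with value -f < 0 at y = 0 and supremum 1/x - F, which is not attained;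
   so it vanishes for some y > 0, necessarily unique, exactly when x < 1/F. *)

(** * Real powers with base in (0, 1) *)

Section PowR.
Context {R : realType}.
Implicit Types a b s u v : R.

Lemma powR_expR_ln a u : 0 < a -> a `^ u = expR (u * ln a).
Proof. by move=> a0; rewrite /powR gt_eqF. Qed.

Lemma gtr_powR a u v : 0 < a < 1 -> u < v -> a `^ v < a `^ u.
Proof.
move=> /andP[a0 a1] uv; rewrite !powR_expR_ln// ltr_expR ltr_nM2r//.
by rewrite ln_lt0 ?a0.
Qed.

Lemma powR_lt1 a s : 0 < a < 1 -> 0 < s -> a `^ s < 1.
Proof. by move=> a01 s0; have := gtr_powR a01 s0; rewrite powRr0. Qed.

Lemma ltr_powR2r s a b : 0 < s -> 0 < a -> a < b -> a `^ s < b `^ s.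
Proof.
move=> s0 a0 ab; apply: gt0_ltr_powR => //; rewrite nnegrE ltW//.
exact: lt_trans ab.
Qed.

Lemma continuous_powR a : 0 < a -> continuous (powR a : R -> R).
Proof.
move=> a0 u.
rewrite (_ : powR a = expR \o (fun v => v * ln a)); last first.
  by apply/funext => v; rewrite powR_expR_ln.
apply: continuous_comp; last exact: continuous_expR.
exact: mulrr_continuous.
Qed.

Lemma powR_lt_ex a b : 0 < a < 1 -> 0 < b -> exists2 u, 0 < u & a `^ u < b.
Proof.
move=> a01 b0; have [a0 a1] := andP a01.
have la : ln a < 0 by exact: ln_lt0.
have [b1|b1] := ltP b 1; last first.
  by exists 1 => //; apply: lt_le_trans b1; exact: powR_lt1.
(* The logarithm of b / 2 to base a: both logarithms are negative, and a ^ u = b / 2 < b. *)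
exists (ln (b / 2) / ln a).
  by rewrite -mulrNN mulr_gt0 ?oppr_gt0 ?invr_lt0// ln_lt0//; lra.
by rewrite powR_expR_ln// divfK ?lt_eqF// lnK ?posrE; lra.
Qed.

End PowR.

(** * Numerical bounds on the exponential *)

Section ExponentialBounds.
Context {R : realType}.

Lemma expR_ge_series (x : R) n : 0 <= x ->
  \sum_(0 <= i < n) x ^+ i / i`!%:R <= expR x.
Proof.
move=> x0; apply: (nondecreasing_cvgn_le (u_ := series (exp_coeff x))).
  apply/nondecreasing_seqP => k; rewrite /series/= big_nat_recr//= lerDl.
  by rewrite exp_coeff_ge0.
exact: is_cvg_series_exp_coeff.
Qed.

Lemma expR_4_5_gt : 100 / 45 < expR (8 / 10) :> R.
Proof.
have x0 : 0 <= 8 / 10 :> R by lra.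
(* Six terms of the series give about 2.2251, against 100 / 45 = 2.222... *)
apply: lt_le_trans (expR_ge_series 6 x0).
by rewrite !big_nat_recr//= big_geq// !factS fact0; lra.
Qed.

(** Equivalently 0.36 < exp(-500/499). The exponent is cut into 50 equal parts, [1 + u <= expR u] is
    applied at u = -10/499, and the 50th power is taken as 2 * 5 * 5, rounding down at each stage to
    keep the rationals small. *)
Lemma expR_500_499_lt : expR (500 / 499) < 100 / 36 :> R.
Proof.
rewrite -ltf_pV2 ?posrE ?expR_gt0 ?divr_gt0// invf_div -expRN.
rewrite (_ : - (500 / 499) = (2 * 5 * 5)%N%:R * - (10 / 499)); last by lra.
rewrite expRM_natl !exprM.
have a1 : 1 - 10 / 499 <= expR (- (10 / 499)) :> R by exact: expR_ge1Dx.
have a2 : 96 / 100 <= expR (- (10 / 499)) ^+ 2 :> R.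
  apply: le_trans (_ : (1 - 10 / 499) ^+ 2 <= _); first by lra.
  by apply: lerXn2r => //; rewrite nnegrE; [lra|exact: expR_ge0].
have a10 : 8153 / 10000 <= (expR (- (10 / 499)) ^+ 2) ^+ 5 :> R.
  apply: le_trans (_ : (96 / 100) ^+ 5 <= _); first by lra.
  by apply: lerXn2r => //; rewrite nnegrE; [lra|exact: sqr_ge0].
apply: lt_le_trans (_ : (8153 / 10000) ^+ 5 <= _); first by clear; lra.
by apply: lerXn2r => //; rewrite nnegrE; [|apply: le_trans a10]; clear; lra.
Qed.

End ExponentialBounds.

(** * Monotonicity, bounds and roots of the rate of return for t >= 2 *)

Section Lottery.
Context {R : realType} (l : lottery R).
Hypothesis t_gt1 : (1 < tickets l)%N.
Implicit Types x y z : R.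
Local Notation t := ((tickets l)%:R : R).
Local Notation F := (Fval l).
Local Notation f := (fval l).

Lemma pjack_bounds : 0 < 1 - pjack l < 1.
Proof.
have t0 : 0 < t by rewrite ltr0n ltnW.
by rewrite /pjack div1r subr_gt0 invf_lt1// ltr1n t_gt1 gtrBl invr_gt0.
Qed.

Lemma pjack_le_ppari (i : 'I_(npari l)) : pjack l <= ppari i.
Proof. by rewrite ler_pM2r ?invr_gt0 ?ltr0n ?(tickets_gt0 l)// ler1n tpari_gt0. Qed.

Lemma ppari_bounds (i : 'I_(npari l)) : 0 < 1 - ppari i < 1.
Proof.
have t0 : 0 < t by rewrite ltr0n ltnW.
rewrite gtrBl (lt_le_trans _ (pjack_le_ppari i)) ?divr_gt0// andbT subr_gt0.
(* The jackpot ticket lies outside class i, which makes [tpari i < tickets l] strict. *)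
rewrite ltr_pdivrMr// mul1r ltr_nat; have := winners_le l.
rewrite addn1 (bigD1 i)//= addnCA => /(leq_ltn_trans _); apply.
exact: leq_addr.
Qed.

Hypothesis hl : standing_assumption l.

Lemma J0_gt0 : 0 < J0 l.
Proof. by case: hl => F0 _ _; rewrite mulr_gt0 ?ltr0n ?(tickets_gt0 l). Qed.

(** Powers with base in (0, 1) decrease in the exponent. The pari-mutuel sum may be empty, so it is
    compared weakly; strictness comes from the jackpot term. *)
Lemma eRoR_increasing x y z : 0 < x -> y < z -> eRoR l x y < eRoR l x z.
Proof.
move=> x0 yz.
have e : x * y * J0 l < x * z * J0 l by rewrite ltr_pM2r ?J0_gt0// ltr_pM2l.
rewrite /eRoR ler_ltD//.
  rewrite lerD2l; apply: ler_sum => i _.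
  rewrite ler_pM2l ?potrate_gt0// lerD2l lerN2 ltW//.
  by rewrite gtr_powR ?ppari_bounds.
by rewrite ltr_pM2r ?invr_gt0// ltrD2l ltrN2 gtr_powR ?pjack_bounds.
Qed.

Lemma eRoR_continuous x : continuous (eRoR l x : R -> R).
Proof.
have c0 a : 0 < a -> continuous (fun y : R => 1 - a `^ (x * y * J0 l)).
  move=> a0 y; apply: cvgB; first exact: cvg_cst.
  apply: (@continuous_comp _ _ _ (fun y : R => x * y * J0 l) (powR a)).
    apply: cvgM; last exact: cvg_cst.
    by apply: cvgM; [exact: cvg_cst|exact: cvg_id].
  exact: continuous_powR.
move=> y; apply: cvgD.
  apply: cvgD; first exact: cvg_cst.
  apply: cvg_big => [|i _]; first exact: add_continuous.
  apply: cvgM; first exact: cvg_cst.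
  by apply: c0; case/andP: (ppari_bounds i).
apply: cvgM; last exact: cvg_cst.
by apply: c0; case/andP: pjack_bounds.
Qed.

Lemma eRoR0 x : eRoR l x 0 = - f.
Proof.
rewrite /eRoR mulr0 mul0r !powRr0 subrr mul0r addr0 big1 ?addr0// => i _.
by rewrite powRr0 subrr mulr0.
Qed.

Lemma eRoR_ge_jackpot x y : 0 < x -> 0 < y ->
  - f + (1 - (1 - pjack l) `^ (x * y * J0 l)) / x <= eRoR l x y.
Proof.
move=> x0 y0; rewrite /eRoR lerD2r lerDl; apply: sumr_ge0 => i _.
rewrite mulr_ge0 ?ltW ?potrate_gt0// subr_gt0.
by rewrite powR_lt1 ?ppari_bounds// mulr_gt0 ?J0_gt0// mulr_gt0.
Qed.

Lemma eRoR_le_jackpot x y :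
  eRoR l x y <= - F + (1 - (1 - pjack l) `^ (x * y * J0 l)) / x.
Proof.
rewrite /eRoR lerD2r (_ : - F = - f + \sum_(i < npari l) potrate i); last first.
  by rewrite opprB addrC.
rewrite lerD2l; apply: ler_sum => i _.
by rewrite ler_piMr ?gerBl ?powR_ge0// ltW ?potrate_gt0.
Qed.

Lemma eRoR_lt_limit x y : 0 < x -> eRoR l x y < - F + 1 / x.
Proof.
move=> x0; apply: le_lt_trans (eRoR_le_jackpot x y) _.
rewrite ltrD2l ltr_pM2r ?invr_gt0// gtrBl powR_gt0//.
by case/andP: pjack_bounds.
Qed.

(* Since p <= p_i, every pari-mutuel factor can be replaced by the jackpot one. *)
Lemma eRoR_ge_pjack x y : 0 < x -> 0 < y ->
  - f + (f - F + 1 / x) * (1 - (1 - pjack l) `^ (x * y * J0 l)) <= eRoR l x y.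
Proof.
move=> x0 y0; set q := _ `^ _.
rewrite /eRoR -/q mulrDl addrA [1 / x * _]mulrC mulrA mulr1 lerD2r lerD2l.
(* Here f - F is the sum of the [potrate i], which allows a termwise comparison. *)
rewrite /Fval opprB addrC subrK mulr_suml; apply: ler_sum => i _.
rewrite ler_pM2l ?potrate_gt0// lerD2l lerN2 ge0_ler_powR//.
- by rewrite ltW// mulr_gt0 ?J0_gt0// mulr_gt0.
- by rewrite nnegrE ltW//; case/andP: (ppari_bounds i).
- by rewrite nnegrE ltW//; case/andP: pjack_bounds.
- by rewrite lerD2l lerN2 pjack_le_ppari.
Qed.

Lemma eRoR_pos_ex x : 0 < x < 1 / F -> exists2 y, 0 < y & 0 < eRoR l x y.
Proof.
move=> /andP[x0 xF]; case: hl => F0 Ff f1.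
have A0 : f < f - F + 1 / x.
  by rewrite -addrA ltrDl addrC subr_gt0 ltr_pdivlMr// mulrC -ltr_pdivlMr.
set A := f - F + 1 / x in A0.
have f0 : 0 < f by exact: lt_le_trans Ff.
have Agt0 : 0 < A by exact: lt_trans A0.
have [|u u0 hu] := @powR_lt_ex R _ (1 - f / A) pjack_bounds.
  by rewrite subr_gt0 ltr_pdivrMr// mul1r.
have xJ0 : 0 < x * J0 l by rewrite mulr_gt0 ?J0_gt0.
(* This y makes the exponent x y J0 equal to u. *)
exists (u / (x * J0 l)); first by rewrite divr_gt0.
apply: lt_le_trans (eRoR_ge_pjack x0 _); last by rewrite divr_gt0.
rewrite (_ : x * _ * J0 l = u); last first.
  by rewrite mulrAC mulrCA divff ?mulr1 ?gt_eqF.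
rewrite addrC subr_gt0 -/A mulrC -ltr_pdivrMr//.
by rewrite ltrBrDl -ltrBrDr.
Qed.

Lemma eRoR_root x : 0 < x < 1 / F -> exists2 y, 0 < y & eRoR l x y = 0.
Proof.
move=> hx; have [M M0 hM] := eRoR_pos_ex hx.
case: hl => F0 Ff _.
have f0 : 0 < f by exact: lt_le_trans Ff.
have m0 : eRoR l x 0 < 0 by rewrite eRoR0 oppr_lt0.
have [||c] := @IVT R (eRoR l x) 0 M 0 (ltW M0).
- exact/continuous_subspaceT/eRoR_continuous.
- by rewrite ge_min le_max (ltW m0) (ltW hM) orbT.
rewrite in_itv/= => /andP[c0 _] hc; exists c => //.
(* The root is not the endpoint 0, where the value is -f < 0. *)
by rewrite lt_neqAle c0 andbT; apply/eqP => c0'; rewrite -c0' in hc; lra.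
Qed.

Lemma eRoR_root_domain x y : 0 < x -> eRoR l x y = 0 -> x < 1 / F.
Proof.
move=> x0 h; case: hl => F0 _ _; have := eRoR_lt_limit y x0; rewrite h.
by rewrite addrC subr_gt0 !ltr_pdivlMr// mulrC.
Qed.

Lemma break_even_graph_ex : exists ell : R -> R,
  [/\ break_even_graph l ell,
      forall x y, above_break_even l ell x y -> 0 < eRoR l x y &
      forall x y, below_break_even l ell x y -> eRoR l x y < 0].
Proof.
(* On (0, 1/F) a positive root exists, so the default 1 can occur only outside that interval. *)
pose ell x := xget 1 [set y | 0 < y /\ eRoR l x y = 0].
have ellP x : 0 < x < 1 / F -> 0 < ell x /\ eRoR l x (ell x) = 0.
  move=> /eRoR_root[y y0 hy].
  by apply: (xgetPex 1 (P := [set y | 0 < y /\ eRoR l x y = 0])); exists y.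
exists ell; split.
- split=> [x /ellP[]//|].
  apply/seteqP; split => -[x y]/=.
    move=> [x0 y0 hxy]; have xF := eRoR_root_domain x0 hxy.
    have xD : 0 < x < 1 / F by rewrite x0.
    have [_ he] := ellP _ xD; split => //.
    (* Two distinct roots would give 0 < 0 by strict monotonicity. *)
    case: (ltgtP y (ell x)) => // /(eRoR_increasing x0); rewrite hxy he ltxx//.
  by move=> [xD ->]; have [? ?] := ellP _ xD; case/andP: xD.
- move=> x y [xD]; have [_ he] := ellP _ xD; case/andP: xD => x0 _.
  by move=> /(eRoR_increasing x0); rewrite he.
- move=> x y [xD] /andP[_]; have [_ he] := ellP _ xD; case/andP: xD => x0 _.
  by move=> /(eRoR_increasing x0); rewrite he.
Qed.

End Lottery.

(** * Comparison with U and L for major lotteries *)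

Section Major.
Context {R : realType} (l : lottery R).
Hypotheses (hl : standing_assumption l) (hmajor : major l).
Hypothesis hF : 8 / 10 <= Fval l.
Implicit Types x y : R.
Local Notation t := ((tickets l)%:R : R).

Let t_ge500 : 500 <= t. Proof. by rewrite ler_nat. Qed.

Let t_gt1 : (1 < tickets l)%N. Proof. exact: leq_trans hmajor. Qed.

(** From 1 - p <= exp(-p) and p J0 = F >= 0.8. *)
Lemma powR_pjack_J0_lt : (1 - pjack l) `^ J0 l < 45 / 100.
Proof.
have [q0 q1] := andP (pjack_bounds t_gt1).
apply: le_lt_trans (_ : expR (- (8 / 10)) < _); last first.
  rewrite expRN -[ltRHS]invrK ltf_pV2 ?posrE ?expR_gt0 ?invr_gt0 ?divr_gt0//.
  by rewrite invf_div expR_4_5_gt.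
apply: le_trans (_ : expR (- pjack l) `^ J0 l <= _).
  apply: ge0_ler_powR; rewrite ?nnegrE ?expR_ge0//.
  - exact/ltW/J0_gt0.
  - exact: ltW.
  - exact: expR_ge1Dx.
rewrite -expRM ler_expR mulNr lerN2 /pjack /J0 div1r mulrCA mulVf ?mulr1//.
by have := t_ge500; lra.
Qed.

(** Since 1 - 1/t is the inverse of 1 + 1/(t - 1), it is at least exp(-1/(t - 1)). As F <= 1, J0/(t
    - 1) <= t/(t - 1), and this is at most 500/499 because t >= 500. *)
Lemma powR_pjack_J0_gt : 36 / 100 < (1 - pjack l) `^ J0 l.
Proof.
have t5 := t_ge500; case: hl => F0 Ff f1.
apply: (@lt_le_trans _ _ (expR (- (500 / 499)))).
  rewrite expRN -[ltLHS]invrK ltf_pV2 ?posrE ?expR_gt0 ?invr_gt0 ?divr_gt0//.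
  by rewrite invf_div expR_500_499_lt.
have h : expR (- (t - 1)^-1) <= 1 - pjack l.
  rewrite expRN (_ : 1 - pjack l = (1 + (t - 1)^-1)^-1).
    rewrite lef_pV2 ?posrE ?expR_gt0 ?expR_ge1Dx// addr_gt0 ?invr_gt0//; lra.
  by rewrite /pjack; field; lra.
apply: (@le_trans _ _ (expR (- (t - 1)^-1) `^ J0 l)).
  rewrite -expRM ler_expR mulNr lerN2 /J0 mulrC ler_pdivrMr; last lra.
  have Ft : Fval l * t <= t by rewrite ler_piMl//; lra.
  by lra.
apply: ge0_ler_powR; rewrite ?nnegrE ?expR_ge0//.
- exact/ltW/J0_gt0.
- by apply: le_trans h; exact: expR_ge0.
Qed.

Lemma curveU_lt_eRoR x y : 0 < x -> 0 < y -> curveU_fun x y < eRoR l x y.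
Proof.
move=> x0 y0; have [q0 _] := andP (pjack_bounds t_gt1).
apply: lt_le_trans (eRoR_ge_jackpot t_gt1 hl x0 y0).
case: hl => _ _ f1; rewrite /curveU_fun ler_ltD ?lerN2//.
(* Regrouping the exponent gives ((1 - p)^J0)^(xy), so only the bases remain to be compared. *)
rewrite ltr_pM2r ?invr_gt0// ltrD2l ltrN2 [x * y * _]mulrC [(1 - _) `^ _]powRrM.
rewrite ltr_powR2r ?mulr_gt0 ?powR_gt0//; exact: powR_pjack_J0_lt.
Qed.

Lemma eRoR_lt_curveL x y : 0 < x -> 0 < y -> eRoR l x y < curveL_fun x y.
Proof.
move=> x0 y0; apply: le_lt_trans (eRoR_le_jackpot l x y) _.
rewrite /curveL_fun ler_ltD ?lerN2//.
rewrite ltr_pM2r ?invr_gt0// ltrD2l ltrN2 [x * y * _]mulrC [(1 - _) `^ _]powRrM.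
rewrite ltr_powR2r ?mulr_gt0//; exact: powR_pjack_J0_gt.
Qed.

Lemma drawing_coords_gt0 (D : drawing R) : 0 < xcoord D /\ 0 < ycoord l D.
Proof.
split; rewrite divr_gt0 ?sales_gt0 ?jackpot_gt0//; exact: J0_gt0.
Qed.

End Major.

Theorem theorem6p5 (R : realType) (l : lottery R)
    (hl : standing_assumption l) (hmajor : major l) (hF : 8 / 10 <= Fval l) :
  [/\ (forall x y : R, break_even l (x, y) -> curveU_fun x y < 0 /\ 0 < curveL_fun x y),
      (exists ell : R -> R,
        [/\ break_even_graph l ell,
            (forall D : drawing R,
               above_break_even l ell (xcoord D) (ycoord l D) ->
               0 < eRoR l (xcoord D) (ycoord l D)) &
            (forall D : drawing R,
               below_break_even l ell (xcoord D) (ycoord l D) ->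
               eRoR l (xcoord D) (ycoord l D) < 0)]),
      (forall D : drawing R, 0 < curveU_fun (xcoord D) (ycoord l D) ->
         0 < eRoR l (xcoord D) (ycoord l D)) &
      (forall D : drawing R, curveL_fun (xcoord D) (ycoord l D) < 0 ->
         eRoR l (xcoord D) (ycoord l D) < 0)].
Proof.
split.
(* Writing 0 as the rate at (x, y) turns both claims into the two-sided bound. *)
- move=> x y [/= x0 y0 h]; rewrite -h.
  by split; [exact: curveU_lt_eRoR|exact: eRoR_lt_curveL].
- have [|ell [hell above below]] := break_even_graph_ex (leq_trans _ hmajor) hl.
    by [].
  by exists ell; split => // D; [exact: above|exact: below].
- move=> D /lt_trans; apply.
  by have [x0 y0] := drawing_coords_gt0 hl D; exact: curveU_lt_eRoR.
- move=> D; apply: lt_trans.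
  by have [x0 y0] := drawing_coords_gt0 hl D; exact: eRoR_lt_curveL.
Qed.
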